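(* There are three proper semisimple subalgebras of $\mathfrak{so}(4,\mathbb{C})$, up to inner automorphism, and each is isomorphic to $\mathfrak{sl}(2,\mathbb{C})$. They are $$A_1^1=\langle h_1,x_1,y_1\rangle,\qquad A_1^2=\langle h_2,x_2,y_2\rangle,\qquad A_1^3=\langle h_1+h_2,\ x_1+x_2,\ y_1+y_2\rangle.$$ That is, every proper semisimple subalgebra of $\mathfrak{so}(4,\mathbb{C})$ is equivalent to exactly one of these three.
   Context: $\mathfrak{so}(4,\mathbb{C})\cong\mathfrak{sl}(2,\mathbb{C})\oplus\mathfrak{sl}(2,\mathbb{C})$ is realized as the Lie algebra of $4\times4$ complex block diagonal matrices with two traceless $2\times 2$ diagonal blocks. With $E_{ij}$ the $4\times 4$ matrix units, its Chevalley basis is $x_1=E_{12}$, $y_1=E_{21}$, $h_1=E_{11}-E_{22}$, $x_2=E_{34}$, $y_2=E_{43}$, $h_2=E_{33}-E_{44}$. The notation $\langle\cdots\rangle$ denotes complex linear span. Semisimple Lie algebras are understood to be nonzero. The inner automorphisms of $\mathfrak{so}(4,\mathbb{C})$ are the maps $X\mapsto AXA^{-1}$ with $A\in SL(2,\mathbb{C})\times SL(2,\mathbb{C})$ (block diagonal $4\times4$ matrices with both $2\times2$ blocks of determinant $1$). Two subalgebras $S,S'$ are equivalent (up to inner automorphism), written $S\sim S'$, if $\psi(S)=S'$ for some inner automorphism $\psi$ of $\mathfrak{so}(4,\mathbb{C})$. *)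

(* Defs.v *)
From mathcomp Require Import all_boot all_order all_algebra.
From mathcomp Require Export complex reals.

Set Implicit Arguments.
Unset Strict Implicit.
Unset Printing Implicit Defensive.

Import GRing.Theory.
Local Open Scope ring_scope.

(* Lie algebras of n x n matrices, as subspaces of 'M[F]_n *)

Definition lie_bracket (F : fieldType) (n : nat) (X Y : 'M[F]_n) : 'M[F]_n :=
  X *m Y - Y *m X.

Definition lie_subalgebra (F : fieldType) (n : nat) (S : {vspace 'M[F]_n}) :=
  {in S &, forall X Y, lie_bracket X Y \in S}.

Definition lie_ideal (F : fieldType) (n : nat) (I S : {vspace 'M[F]_n}) :=
  (I <= S)%VS /\ {in S & I, forall X Y, lie_bracket X Y \in I}.

(* By bilinearity, brackets of basis vectors suffice; see [lie_prodvP]. *)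
Definition lie_prodv (F : fieldType) (n : nat) (U V : {vspace 'M[F]_n}) :
    {vspace 'M[F]_n} :=
  <<allpairs (@lie_bracket F n) (vbasis U) (vbasis V)>>%VS.

Definition derived_series (F : fieldType) (n : nat) (S : {vspace 'M[F]_n})
    (k : nat) : {vspace 'M[F]_n} :=
  iter k (fun U => lie_prodv U U) S.

Definition lie_solvable (F : fieldType) (n : nat) (S : {vspace 'M[F]_n}) :=
  exists k, derived_series S k = 0%VS.

(* The radical (the largest solvable ideal) is zero, and S itself is not. *)
Definition lie_semisimple (F : fieldType) (n : nat) (S : {vspace 'M[F]_n}) :=
  S <> 0%VS /\
  (forall I : {vspace 'M[F]_n}, lie_ideal I S -> lie_solvable I -> I = 0%VS).

(* A linear map S -> T is the restriction of one between the ambient matrix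
   spaces; only the values of f on S matter. *)
Definition lie_isomorphic (F : fieldType) (m n : nat)
    (S : {vspace 'M[F]_m}) (T : {vspace 'M[F]_n}) :=
  exists f : 'Hom('M[F]_m, 'M[F]_n),
    [/\ {in S &, forall X Y,
          f (lie_bracket X Y) = lie_bracket (f X) (f Y)},
        {in S &, injective f}
      & (f @: S)%VS = T].

Definition sl (F : fieldType) (n : nat) : {vspace 'M[F]_n} :=
  lker (linfun (@mxtrace F n : 'M[F]_n -> F^o)).

(* so(4), realized as sl(2) + sl(2) in block diagonal form; the dimension is
   written 2 + 2 so that the block operations of matrix.v apply. The four maps
   are ursubmx, dlsubmx, ulsubmx and drsubmx, unfolded because these have no
   canonical linear structure; see [mem_so4]. *)
Definition so4 (F : fieldType) : {vspace 'M[F]_(2 + 2)} :=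
  (lker (linfun (@rsubmx F 2 2 2 \o @usubmx F 2 2 (2 + 2)))
   :&: lker (linfun (@lsubmx F 2 2 2 \o @dsubmx F 2 2 (2 + 2)))
   :&: (linfun (@lsubmx F 2 2 2 \o @usubmx F 2 2 (2 + 2)) @^-1: sl F 2)
   :&: (linfun (@rsubmx F 2 2 2 \o @dsubmx F 2 2 (2 + 2)) @^-1: sl F 2))%VS.

Definition SL2xSL2 (F : fieldType) : {pred 'M[F]_(2 + 2)} :=
  fun A => [&& ursubmx A == 0, dlsubmx A == 0,
               \det (ulsubmx A) == 1 & \det (drsubmx A) == 1].

Definition conj_by (F : fieldType) (n : nat) (A : 'M[F]_n) : 'End('M[F]_n) :=
  linfun (mulmxr (invmx A) \o mulmx A).

(* An inner automorphism of so(4), as the conjugation of the whole matrix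
   space that it extends to. *)
Definition so4_inner (F : fieldType) (psi : 'End('M[F]_(2 + 2))) :=
  exists2 A, A \in @SL2xSL2 F & psi = conj_by A.

Definition so4_equiv (F : fieldType) (S S' : {vspace 'M[F]_(2 + 2)}) :=
  exists2 psi, so4_inner psi & (psi @: S)%VS = S'.

Definition proper_semisimple_subalgebra (F : fieldType)
    (S : {vspace 'M[F]_(2 + 2)}) :=
  [/\ (S <= so4 F)%VS, S <> so4 F, lie_subalgebra S & lie_semisimple S].

(* Matrix units, indexed from 1 *)
Definition E (F : fieldType) (i j : nat) : 'M[F]_(2 + 2) :=
  delta_mx (@inord 3 i.-1) (@inord 3 j.-1).

Definition x1 (F : fieldType) : 'M[F]_(2 + 2) := E F 1 2.
Definition y1 (F : fieldType) : 'M[F]_(2 + 2) := E F 2 1.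
Definition h1 (F : fieldType) : 'M[F]_(2 + 2) := E F 1 1 - E F 2 2.
Definition x2 (F : fieldType) : 'M[F]_(2 + 2) := E F 3 4.
Definition y2 (F : fieldType) : 'M[F]_(2 + 2) := E F 4 3.
Definition h2 (F : fieldType) : 'M[F]_(2 + 2) := E F 3 3 - E F 4 4.

Definition A11 (F : fieldType) : {vspace 'M[F]_(2 + 2)} :=
  <<[:: h1 F; x1 F; y1 F]>>%VS.
Definition A12 (F : fieldType) : {vspace 'M[F]_(2 + 2)} :=
  <<[:: h2 F; x2 F; y2 F]>>%VS.
Definition A13 (F : fieldType) : {vspace 'M[F]_(2 + 2)} :=
  <<[:: (h1 F + h2 F)%R; (x1 F + x2 F)%R; (y1 F + y2 F)%R]>>%VS.

Definition A1 (F : fieldType) (i : 'I_3) : {vspace 'M[F]_(2 + 2)} :=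
  tnth [tuple A11 F; A12 F; A13 F] i.

Lemma lie_prodvP (F : fieldType) (n : nat) (U V W : {vspace 'M[F]_n}) :
  reflect {in U & V, forall X Y, lie_bracket X Y \in W} (lie_prodv U V <= W)%VS.
Proof.
apply: (iffP span_subvP) => [sub X Y XU YV | sub _ /allpairsP[[X Y] /= [XU YV ->]]].
  rewrite (coord_vbasis XU) (coord_vbasis YV) /lie_bracket mulmx_suml mulmx_sumr.
  rewrite -sumrB; apply: memv_suml => i _.
  rewrite mulmx_sumr mulmx_suml -sumrB; apply: memv_suml => j _.
  rewrite -!scalemxAl -!scalemxAr !scalerA mulrC -scalerBr memvZ //.
  by apply/sub/allpairs_f; apply: mem_nth; rewrite size_tuple.
by apply: sub; apply: vbasis_mem.
Qed.

Lemma mem_sl (F : fieldType) (n : nat) (X : 'M[F]_n) :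
  (X \in sl F n) = (\tr X == 0).
Proof. by rewrite memv_ker lfunE. Qed.

Lemma mem_so4 (F : fieldType) (X : 'M[F]_(2 + 2)) :
  (X \in so4 F) = [&& ursubmx X == 0, dlsubmx X == 0,
                      \tr (ulsubmx X) == 0 & \tr (drsubmx X) == 0].
Proof.
by rewrite !memv_cap !memv_ker -!memv_preim !mem_sl !lfunE /= -!andbA.
Qed.

Lemma conj_byE (F : fieldType) (n : nat) (A X : 'M[F]_n) :
  conj_by A X = A *m X *m invmx A.
Proof. by rewrite lfunE. Qed.

(* Main.v *)
Require Import Defs.
From mathcomp Require Import all_boot all_order all_algebra.
From mathcomp Require Import complex reals ring.

(* Let p, q be the projections of S to the two blocks. If neither maps S onto
   sl(2), both images have dimension at most 2, hence S is solvable, which is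
   excluded. Say p(S) = sl(2). The kernel of p on S is an ideal; it vanishes,
   since otherwise it would be solvable or, by simplicity of sl(2), fill the
   other block and make S equal to so(4). So S is spanned by lifts of the
   standard triple, whose image under q is either zero or an sl(2)-triple of
   2x2 matrices; the latter is conjugate under SL(2) to the standard one. The
   three normal forms differ in which of the two blocks vanish on them. *)

Set Implicit Arguments.
Unset Strict Implicit.
Unset Printing Implicit Defensive.

Import GRing.Theory Num.Theory.
Local Open Scope ring_scope.

(** * Bilinearity of the bracket and membership in small spans *)

Lemma lie_bracketDl (F : fieldType) n (X Y Z : 'M[F]_n) :
  lie_bracket (X + Y) Z = lie_bracket X Z + lie_bracket Y Z.
Proof. by rewrite /lie_bracket mulmxDl mulmxDr opprD addrACA. Qed.

Lemma lie_bracketC (F : fieldType) n (X Y : 'M[F]_n) :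
  lie_bracket X Y = - lie_bracket Y X.
Proof. by rewrite /lie_bracket opprB. Qed.

Lemma lie_bracketDr (F : fieldType) n (X Y Z : 'M[F]_n) :
  lie_bracket X (Y + Z) = lie_bracket X Y + lie_bracket X Z.
Proof. by rewrite !(lie_bracketC X) lie_bracketDl opprD. Qed.

Lemma lie_bracketZl (F : fieldType) n a (X Y : 'M[F]_n) :
  lie_bracket (a *: X) Y = a *: lie_bracket X Y.
Proof. by rewrite /lie_bracket -scalemxAl -scalemxAr scalerBr. Qed.

Lemma lie_bracketZr (F : fieldType) n a (X Y : 'M[F]_n) :
  lie_bracket X (a *: Y) = a *: lie_bracket X Y.
Proof. by rewrite !(lie_bracketC X) lie_bracketZl scalerN. Qed.

Lemma lie_bracketXX (F : fieldType) n (X : 'M[F]_n) : lie_bracket X X = 0.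
Proof. exact: subrr. Qed.

Lemma mxtrace_lie_bracket (F : fieldType) n (X Y : 'M[F]_n) :
  \tr (lie_bracket X Y) = 0.
Proof. by rewrite raddfB /= mxtrace_mulC subrr. Qed.

Lemma span2P (F : fieldType) (V : vectType F) (u v w : V) :
  w \in <<[:: u; v]>>%VS -> exists a b, w = a *: u + b *: v.
Proof.
rewrite !span_cons span_nil addv0.
by case/memv_addP=> _ /vlineP[a ->] [_ /vlineP[b ->] ->]; exists a, b.
Qed.

Lemma span3P (F : fieldType) (V : vectType F) (u v w z : V) :
  z \in <<[:: u; v; w]>>%VS -> exists a b c, z = a *: u + b *: v + c *: w.
Proof.
rewrite span_cons => /memv_addP[_ /vlineP[a ->] [_ /span2P[b [c ->]] ->]].
by exists a, b, c; rewrite addrA.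
Qed.

(** * Triples satisfying the relations of sl(2), in matrices of any size *)

(** The condition [h <> 0] excludes the zero triple; in characteristic zero it makes the three
    matrices linearly independent. *)
Definition sl2_triple (F : fieldType) n (h x y : 'M[F]_n) :=
  [/\ lie_bracket h x = 2%:R *: x, lie_bracket h y = - 2%:R *: y,
      lie_bracket x y = h & h <> 0].

(** The structure constants in coordinates: they show that the span is a subalgebra and that
    matching two triples preserves brackets. *)
Lemma sl2_triple_bracket (F : fieldType) n (h x y : 'M[F]_n) a b c a' b' c' :
  sl2_triple h x y ->
  lie_bracket (a *: h + b *: x + c *: y) (a' *: h + b' *: x + c' *: y) =
  (b * c' - c * b') *: h + (2%:R * (a * b' - b * a')) *: x
    + (- 2%:R * (a * c' - c * a')) *: y.
Proof.
case=> hx hy xy _.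
have xh : lie_bracket x h = - 2%:R *: x by rewrite lie_bracketC hx scaleNr.
have yh : lie_bracket y h = 2%:R *: y.
  by rewrite lie_bracketC hy scaleNr opprK.
have yx : lie_bracket y x = - 1 *: h by rewrite lie_bracketC xy scaleN1r.
rewrite !(lie_bracketDl, lie_bracketDr, lie_bracketZl, lie_bracketZr).
rewrite !lie_bracketXX hx hy xy xh yh yx -{1}[h]scale1r.
apply/matrixP=> i j; rewrite !mxE.
set p := h i j; set q := x i j; set r := y i j.
rewrite !(mulr0, add0r, addr0).
by field.
Qed.

Lemma mem_span3 (F : fieldType) (V : vectType F) (u v w : V) a b c :
  a *: u + b *: v + c *: w \in <<[:: u; v; w]>>%VS.
Proof.
by rewrite !memvD ?memvZ // memv_span // !inE eqxx ?orbT.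
Qed.

Lemma span3_subv (F : fieldType) (V : vectType F) (u v w : V) (U : {vspace V}) :
  u \in U -> v \in U -> w \in U -> (<<[:: u; v; w]>> <= U)%VS.
Proof.
by move=> Uu Uv Uw; apply/span_subvP=> z; rewrite !inE => /or3P[] /eqP->.
Qed.

(** Weight decomposition: [h], [x], [y] are eigenvectors of bracketing with [h] for the distinct
    eigenvalues 0, 2, -2, so an invariant subspace contains each weight component of its
    elements. *)
Lemma sl2_triple_stable (F : numFieldType) n (h x y : 'M[F]_n)
    (I : {vspace 'M[F]_n}) a b c :
  sl2_triple h x y -> {in I, forall Z, lie_bracket h Z \in I} ->
  a *: h + b *: x + c *: y \in I ->
  [/\ a *: h \in I, b *: x \in I & c *: y \in I].
Proof.
move=> [hx hy _ _] adI IZ.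
have IW : 2%:R *: (b *: x) + - 2%:R *: (c *: y) \in I.
  have := adI _ IZ; rewrite !lie_bracketDr !lie_bracketZr hx hy lie_bracketXX.
  rewrite scaler0 add0r !scalerA; congr (_ *: _ + _ *: _ \in I); ring.
have IW' : 4%:R *: (b *: x) + 4%:R *: (c *: y) \in I.
  have := adI _ IW; rewrite !lie_bracketDr !lie_bracketZr hx hy.
  rewrite !scalerA; congr (_ *: _ + _ *: _ \in I); ring.
have Ix : b *: x \in I.
  (* The coefficients solve the linear system given by applying the bracket with [h] once and
     twice. *)
  have -> : b *: x = 8%:R^-1 *: (4%:R *: (b *: x) + 4%:R *: (c *: y))
     + 4%:R^-1 *: (2%:R *: (b *: x) + - 2%:R *: (c *: y)).
    by apply/matrixP=> i j; rewrite !mxE; field.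
  by rewrite memvD ?memvZ.
have Iy : c *: y \in I.
  have -> : c *: y = 8%:R^-1 *: (4%:R *: (b *: x) + 4%:R *: (c *: y))
     - 4%:R^-1 *: (2%:R *: (b *: x) + - 2%:R *: (c *: y)).
    by apply/matrixP=> i j; rewrite !mxE; field.
  by rewrite memvB ?memvZ.
by split=> //; move: IZ; rewrite -addrA addrC rpredDl // memvD.
Qed.

Lemma sl2_triple_neq0 (F : fieldType) n (h x y : 'M[F]_n) :
  sl2_triple h x y -> [/\ h != 0, x != 0 & y != 0].
Proof.
move=> [_ _ xy /eqP h0]; split=> //; apply: contra_neq h0 => e; rewrite -xy e.
  by rewrite /lie_bracket mul0mx mulmx0 subrr.
by rewrite /lie_bracket mul0mx mulmx0 subrr.
Qed.

(** The zero subspace is invariant under bracketing with [h], so every weight component of a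
    vanishing combination vanishes. *)
Lemma sl2_triple_comb_inj (F : numFieldType) n (h x y : 'M[F]_n) a b c :
  sl2_triple h x y -> a *: h + b *: x + c *: y = 0 -> [/\ a = 0, b = 0 & c = 0].
Proof.
move=> T; have [h0 x0 y0] := sl2_triple_neq0 T.
have adI : {in 0%VS : {vspace 'M[F]_n}, forall Z, lie_bracket h Z \in 0%VS}.
  by move=> Z; rewrite !memv0 => /eqP->;
    rewrite /lie_bracket mul0mx mulmx0 subrr.
have sp := sl2_triple_stable T adI.
move/eqP; rewrite -memv0 => /sp[]; rewrite !memv0 !scaler_eq0.
by rewrite (negPf h0) (negPf x0) (negPf y0) !orbF => /eqP-> /eqP-> /eqP->.
Qed.

Lemma sl2_triple_free (F : numFieldType) n (h x y : 'M[F]_n) :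
  sl2_triple h x y -> free [:: h; x; y].
Proof.
move=> T; suff: free [tuple h; x; y] by [].
apply/freeP=> k.
rewrite !big_ord_recl big_ord0 addr0 addrA.
move=> /(sl2_triple_comb_inj T)[k0 k1 k2].
move=> i; case: (unliftP ord0 i) => [{}i ->|-> //].
case: (unliftP ord0 i) => [{}i ->|-> //].
by case: (unliftP ord0 i) => [[]//|-> //].
Qed.

Lemma sl2_triple_subalgebra (F : fieldType) n (h x y : 'M[F]_n) :
  sl2_triple h x y -> lie_subalgebra <<[:: h; x; y]>>%VS.
Proof.
move=> T X Y /span3P[a [b [c ->]]] /span3P[a' [b' [c' ->]]].
by rewrite (sl2_triple_bracket _ _ _ _ _ _ T) mem_span3.
Qed.

Lemma scaler_mem (F : fieldType) (V : vectType F) (U : {vspace V}) a v :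
  a != 0 -> a *: v \in U -> v \in U.
Proof. by move=> a0 /(memvZ a^-1); rewrite scalerA mulVf ?scale1r. Qed.

(** A nonzero element of the ideal has a nonzero weight component, which lies in the ideal again.
    From [x] or [y] one bracket leads to [h], and from [h] to the whole span. *)
Lemma sl2_triple_simple (F : numFieldType) n (h x y : 'M[F]_n)
    (I : {vspace 'M[F]_n}) :
  sl2_triple h x y -> lie_ideal I <<[:: h; x; y]>>%VS -> I <> 0%VS ->
  I = <<[:: h; x; y]>>%VS.
Proof.
move=> T [sI adI] /eqP I0; have [hx hy xy _] := T.
have two0 : 2%:R != 0 :> F by rewrite pnatr_eq0.
have Lh : h \in <<[:: h; x; y]>>%VS by rewrite memv_span // !inE eqxx.
have Lx : x \in <<[:: h; x; y]>>%VS by rewrite memv_span // !inE eqxx orbT.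
have Ly : y \in <<[:: h; x; y]>>%VS by rewrite memv_span // !inE eqxx !orbT.
apply/eqP; rewrite eqEsubv sI /=.
have gen : h \in I -> (<<[:: h; x; y]>> <= I)%VS.
  move=> Ih; apply: span3_subv => //.
    by have := adI _ _ Lx Ih; rewrite lie_bracketC hx -scaleNr;
      apply: scaler_mem; rewrite oppr_eq0.
  by have := adI _ _ Ly Ih; rewrite lie_bracketC hy scaleNr opprK;
    apply: scaler_mem.
have Zn0 : vpick I != 0 by rewrite vpick0.
move: (memv_pick I) Zn0; set Z := vpick I => IZ.
have /span3P[a [b [c eZ]]] := subvP sI _ IZ.
have [|Ia Ib Ic] := sl2_triple_stable (a:=a) (b:=b) (c:=c) T (adI _ ^~ Lh).
  by rewrite -eZ.
have [a0|/scaler_mem Sa _] := eqVneq a 0; last exact/gen/Sa.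
have [b0|/scaler_mem Sb _] := eqVneq b 0; last first.
  apply: gen; have := adI _ _ Ly (Sb _ _ _ Ib).
  by rewrite lie_bracketC xy memvN.
have [c0|/scaler_mem Sc _] := eqVneq c 0; last first.
  by apply: gen; have := adI _ _ Lx (Sc _ _ _ Ic); rewrite xy.
by rewrite eZ a0 b0 c0 !scale0r !addr0 eqxx.
Qed.

Lemma lie_prodvS (F : fieldType) n (U U' V V' : {vspace 'M[F]_n}) :
  (U <= U')%VS -> (V <= V')%VS -> (lie_prodv U V <= lie_prodv U' V')%VS.
Proof.
move=> sU sV; apply/lie_prodvP=> X Y /(subvP sU) UX /(subvP sV) VY.
by move: UX VY; apply/lie_prodvP/subvv.
Qed.

(** By simplicity a nonzero ideal is the whole span, which is its own derived algebra; its derived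
    series never decreases, so it is not solvable. *)
Lemma sl2_triple_semisimple (F : numFieldType) n (h x y : 'M[F]_n) :
  sl2_triple h x y -> lie_semisimple <<[:: h; x; y]>>%VS.
Proof.
move=> T; have [hx hy xy /eqP h0] := T.
have two0 : 2%:R != 0 :> F by rewrite pnatr_eq0.
set L := <<_>>%VS.
have Lh : h \in L by rewrite memv_span // !inE eqxx.
have Lx : x \in L by rewrite memv_span // !inE eqxx orbT.
have Ly : y \in L by rewrite memv_span // !inE eqxx !orbT.
have L0 : L <> 0%VS by move=> e; move: Lh; rewrite e memv0 (negPf h0).
split=> // I idI [k Ik0]; apply/eqP/contraT=> /eqP I0.
have eI := sl2_triple_simple T idI I0; rewrite {}eI -/L in Ik0.
have perfect : (L <= lie_prodv L L)%VS.
  have br : {in L &, forall X Y, lie_bracket X Y \in lie_prodv L L}.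
    exact/lie_prodvP/subvv.
  apply: span3_subv; first by rewrite -xy br.
    by apply: (scaler_mem two0); rewrite -hx br.
  by apply: (@scaler_mem _ _ _ (- 2%:R)); rewrite ?oppr_eq0 // -hy br.
have : (L <= derived_series L k)%VS.
  elim: k {Ik0} => [|k IH]; first exact: subvv.
  exact: subv_trans perfect (lie_prodvS IH IH).
by rewrite Ik0 subv0 => /eqP.
Qed.


(** The linear map matching the two bases preserves brackets because both have the same structure
    constants. *)
Lemma sl2_triple_isomorphic (F : numFieldType) m n
    (h x y : 'M[F]_m) (h' x' y' : 'M[F]_n) :
  sl2_triple h x y -> sl2_triple h' x' y' ->
  lie_isomorphic <<[:: h; x; y]>>%VS <<[:: h'; x'; y']>>%VS.
Proof.
move=> T T'; have [f fE] := linear_of_free [:: h; x; y] [:: h'; x'; y'].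
have [fh fx fy] := fE (sl2_triple_free T) erefl.
have fc a b c :
    linfun f (a *: h + b *: x + c *: y) = a *: h' + b *: x' + c *: y'.
  by rewrite lfunE !linearD !linearZ /= fh fx fy.
exists (linfun f); split.
- move=> X Y /span3P[a [b [c ->]]] /span3P[a' [b' [c' ->]]].
  by rewrite (sl2_triple_bracket _ _ _ _ _ _ T) !fc
             (sl2_triple_bracket _ _ _ _ _ _ T').
- move=> X Y /span3P[a [b [c ->]]] /span3P[a' [b' [c' ->]]].
  rewrite !fc => /eqP; rewrite -subr_eq0 => /eqP e.
  suff [/subr0_eq-> /subr0_eq-> /subr0_eq->] :
      [/\ a - a' = 0, b - b' = 0 & c - c' = 0] by [].
  apply: (sl2_triple_comb_inj T'); rewrite -[RHS]e.
  by apply/matrixP=> i j; rewrite !mxE; ring.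
- by rewrite limg_span /= !lfunE /= fh fx fy.
Qed.

(** * The algebra sl(2) of 2 x 2 matrices and the conjugacy of its triples *)

Definition sl2_h (F : fieldType) : 'M[F]_2 := delta_mx 0 0 - delta_mx 1 1.
Definition sl2_x (F : fieldType) : 'M[F]_2 := delta_mx 0 1.
Definition sl2_y (F : fieldType) : 'M[F]_2 := delta_mx 1 0.

Lemma matrix2P (T : Type) (A B : 'M[T]_2) :
  A 0 0 = B 0 0 -> A 0 1 = B 0 1 -> A 1 0 = B 1 0 -> A 1 1 = B 1 1 -> A = B.
Proof.
move=> e00 e01 e10 e11; apply/matrixP.
have I2 (i : 'I_2) : i = 0 \/ i = 1.
  by case: i => [[|[|//]] ?]; [left|right]; apply: val_inj.
by move=> i j; case: (I2 i) => ->; case: (I2 j) => ->.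
Qed.

Lemma sl2_std_triple (F : numFieldType) :
  sl2_triple (sl2_h F) (sl2_x F) (sl2_y F).
Proof.
split; last by move/matrixP/(_ 0 0)/eqP; rewrite !mxE /= subr0 oner_eq0.
- by apply: matrix2P; rewrite !(mxE, big_ord_recl, big_ord0) /=; ring.
- by apply: matrix2P; rewrite !(mxE, big_ord_recl, big_ord0) /=; ring.
- by apply: matrix2P; rewrite !(mxE, big_ord_recl, big_ord0) /=; ring.
Qed.

Lemma sl2_std_span (F : numFieldType) :
  sl F 2 = <<[:: sl2_h F; sl2_x F; sl2_y F]>>%VS.
Proof.
apply/eqP; rewrite eqEsubv; apply/andP; split.
  apply/subvP=> X; rewrite mem_sl /mxtrace !big_ord_recl big_ord0 addr0.
  have -> : lift ord0 ord0 = 1 :> 'I_2 by apply: val_inj.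
  rewrite addrC addr_eq0 => /eqP e.
  have -> : X = X 0 0 *: sl2_h F + X 0 1 *: sl2_x F + X 1 0 *: sl2_y F.
    by apply: matrix2P; rewrite ?e !mxE /=; ring.
  exact: mem_span3.
by apply: span3_subv; rewrite mem_sl /mxtrace !(mxE, big_ord_recl, big_ord0) /=;
  apply/eqP; ring.
Qed.

(** Each member of the triple is a multiple of a bracket, hence traceless, and three independent
    vectors fill the three-dimensional sl(2). *)
Lemma sl2_triple_span (F : numFieldType) (h x y : 'M[F]_2) :
  sl2_triple h x y -> <<[:: h; x; y]>>%VS = sl F 2.
Proof.
move=> T; have [hx hy xy _] := T; apply/eqP; rewrite eqEdim; apply/andP; split.
  have two0 : 2%:R != 0 :> F by rewrite pnatr_eq0.
  apply: span3_subv.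
  - by rewrite mem_sl -xy mxtrace_lie_bracket.
  - by apply: (scaler_mem two0); rewrite -hx mem_sl mxtrace_lie_bracket.
  - apply: (@scaler_mem _ _ _ (- 2%:R)); rewrite ?oppr_eq0 //.
    by rewrite -hy mem_sl mxtrace_lie_bracket.
have /eqP-> := sl2_triple_free T.
by rewrite sl2_std_span dim_span.
Qed.

Lemma dim_proper_sl2 (F : numFieldType) (U : {vspace 'M[F]_2}) :
  (U <= sl F 2)%VS -> U <> sl F 2 -> (\dim U <= 2)%N.
Proof.
move=> sU /eqP; rewrite eqEdim sU /= -ltnNge.
move/leq_trans=> /(_ 3); rewrite ltnS; apply.
by rewrite sl2_std_span dim_span.
Qed.

(** The bracket is alternating, so on the span of [u] and [v] it is a determinant times the bracket
    of [u] and [v]. *)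
Lemma lie_bracket_dim2 (F : fieldType) n (U : {vspace 'M[F]_n}) :
  (\dim U <= 2)%N ->
  exists b, {in U &, forall X Y, lie_bracket X Y \in <[b]>%VS}.
Proof.
move=> dU.
have [u [v sU]] : exists u v, (U <= <<[:: u; v]>>)%VS.
  have sz : size (vbasis U) = \dim U by rewrite size_tuple.
  rewrite -{}sz in dU; have := span_basis (vbasisP U).
  case: (tval _) dU => [|u [|v [|//]]] _ <-.
  (* In dimension below 2 the missing generators are taken to be 0. *)
  - by exists 0, 0; rewrite span_nil sub0v.
  - by exists u, 0; rewrite !span_cons span_nil addvS // sub0v.
  - by exists u, v.
exists (lie_bracket u v) => X Y /(subvP sU)/span2P[a [b ->]].
move=> /(subvP sU)/span2P[a' [b' ->]]; apply/vlineP; exists (a * b' - b * a').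
rewrite !(lie_bracketDl, lie_bracketDr, lie_bracketZl, lie_bracketZr).
rewrite !lie_bracketXX [lie_bracket v u]lie_bracketC.
by apply/matrixP=> i j; rewrite !mxE; ring.
Qed.

(** If [[t, X] = a X] with [a] nonzero, then [X] is traceless and its square is a scalar matrix by
    Cayley-Hamilton. The square commutes with [t], yet [[t, XX] = 2a XX], so it is zero. *)
Lemma sl2_triple_nilpotent (F : numFieldType) (h x y : 'M[F]_2) :
  sl2_triple h x y -> [/\ x *m x = 0, y *m y = 0 & x *m y *m x = x].
Proof.
have sq (t X : 'M[F]_2) a : a != 0 -> lie_bracket t X = a *: X -> X *m X = 0.
  move=> a0 tX.
  have tr0 : X 1 1 = - X 0 0.
    have : \tr X == 0.
      by rewrite -mem_sl; apply: (scaler_mem a0); rewrite -tX mem_sl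
                                                 mxtrace_lie_bracket.
    rewrite /mxtrace !big_ord_recl big_ord0 addr0 addrC addr_eq0.
    have -> : lift ord0 ord0 = 1 :> 'I_2 by apply: val_inj.
    by move/eqP.
  have sc : X *m X = (X 0 0 * X 0 0 + X 0 1 * X 1 0)%:M.
    have e1 : lift ord0 ord0 = 1 :> 'I_2 by apply: val_inj.
    apply: matrix2P;
      by rewrite !(mxE, big_ord_recl, big_ord0) /= e1 ?tr0; ring.
  have : (a *+ 2) *: (X *m X) = 0.
    (* Bracketing with [t] is a derivation of the matrix product. *)
    have -> : (a *+ 2) *: (X *m X) = lie_bracket t (X *m X).
      rewrite /lie_bracket !mulmxA.
      have -> : t *m X = a *: X + X *m t by rewrite -tX subrK.
      rewrite mulmxDl -scalemxAl -[X *m t *m X]mulmxA.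
      have -> : t *m X = a *: X + X *m t by rewrite -tX subrK.
      by rewrite mulmxDr -scalemxAr addrA mulmxA addrK -mulr2n -scalerMnl.
    by rewrite sc /lie_bracket scalar_mxC subrr.
  by move/eqP; rewrite scaler_eq0 mulrn_eq0 (negPf a0) /= => /eqP.
have two0 : 2%:R != 0 :> F by rewrite pnatr_eq0.
move=> [hx hy xy _]; have xx := sq _ _ _ two0 hx.
split=> //; first by apply: (sq _ _ _ _ hy); rewrite oppr_eq0.
have hE : h = x *m y - y *m x by rewrite -{1}xy.
(* With [h = xy - yx] and [xx = 0], the bracket [[h, x] = 2x] expands to [2xyx]. *)
apply: (scalerI two0); rewrite -hx /lie_bracket hE.
rewrite mulmxBl mulmxBr !mulmxA xx -(mulmxA y) xx mulmx0 mul0mx.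
rewrite subr0 sub0r opprK.
by rewrite scaler_nat mulr2n.
Qed.

(* With [v = x u <> 0] and [w = y v], the columns of [A] are [v] and [w]: the
   nilpotency relations make [(v, w)] a standard weight basis for the triple. *)
Lemma sl2_triple_conj (F : numClosedFieldType) (h x y : 'M[F]_2) :
  sl2_triple h x y ->
  exists A, [/\ \det A = 1, A *m sl2_h F = h *m A,
    A *m sl2_x F = x *m A & A *m sl2_y F = y *m A].
Proof.
move=> T; have [xx yy xyx] := sl2_triple_nilpotent T.
have [_ x0 _] := sl2_triple_neq0 T; have [_ _ xy _] := T.
have [j cj] : exists j, col j x != 0.
  apply/existsP; apply: contraNT x0 => /existsPn cx.
  apply/eqP/matrixP=> i j; have /negPn/eqP/matrixP/(_ i 0) := cx j.
  by rewrite !mxE.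
(* Right multiplication by [D k] moves column [j] to column [k] and clears the other column. *)
pose D (k : 'I_2) : 'M[F]_2 := delta_mx j k.
pose A := x *m D 0 + y *m x *m D 1.
have Ax : A *m sl2_x F = x *m A.
  rewrite mulmxDr !mulmxA xx xyx mul0mx add0r mulmxDl -!mulmxA.
  by rewrite !mul_delta_mx_cond /= !mulr1n mulr0n !mulmx0 addr0.
have Ay : A *m sl2_y F = y *m A.
  rewrite mulmxDr !mulmxA yy !mul0mx addr0 mulmxDl -!mulmxA.
  by rewrite !mul_delta_mx_cond /= !mulr1n mulr0n !mulmx0 add0r.
have [_ _ std _] := sl2_std_triple F.
have Ah : A *m sl2_h F = h *m A.
  by rewrite -std -xy /lie_bracket mulmxBr mulmxBl !mulmxA Ax Ay -!mulmxA Ax Ay.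
(* [det0P] yields a row vector, hence the transposes. If [A] kills [Z], applying [x] leaves the
   second coordinate of [Z] times [col j x]; once this vanishes, [A] applied to [Z] is the first
   coordinate times the same nonzero column. *)
have dA : \det A != 0.
  rewrite -det_tr; apply/negP=> /det0P[z z0 /(congr1 trmx)].
  rewrite trmx_mul trmxK trmx0; set Z := z^T => AZ.
  have e1 : x *m D 1 *m Z = 0.
    have -> : x *m D 1 = A *m sl2_x F.
      by rewrite Ax mulmxDr !mulmxA xx xyx mul0mx add0r.
    by rewrite Ax -mulmxA AZ mulmx0.
  have e0 : x *m D 0 *m Z = 0.
    by move: AZ; rewrite mulmxDl -2!(mulmxA y) e1 mulmx0 addr0.
  have cZ k : x *m D k *m Z = Z k 0 *: col j x.
    apply/matrixP=> i l; rewrite !mxE (bigD1 k) //= big1 ?addr0 => [|m mk].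
      rewrite !mxE (bigD1 j) //= big1 ?addr0 => [|m mj].
        by rewrite !mxE !eqxx mulr1 ord1 mulrC.
      by rewrite !mxE (negPf mj) mulr0.
    rewrite !mxE big1 ?mul0r // => l' _.
    by rewrite !mxE (negPf mk) andbF mulr0.
  move: e0 e1; rewrite !cZ => /eqP; rewrite scaler_eq0 (negPf cj) orbF => /eqP Z0.
  move/eqP; rewrite scaler_eq0 (negPf cj) orbF => /eqP Z1.
  case/eqP: z0; apply/rowP=> i; rewrite mxE.
  move: Z0 Z1; rewrite !mxE => Z0 Z1.
  by case: i => [[|[|//]] ?]; [rewrite -Z0|rewrite -Z1];
    congr (z _ _); apply: val_inj.
(* A 2 x 2 determinant is quadratic in a scalar factor, so dividing by a square root normalizes it
   to 1 and keeps the intertwining relations. *)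
exists ((sqrtC (\det A))^-1 *: A); split.
- by rewrite detZ exprVn sqrtCK mulVf.
- by rewrite -scalemxAl -scalemxAr Ah.
- by rewrite -scalemxAl -scalemxAr Ax.
- by rewrite -scalemxAl -scalemxAr Ay.
Qed.

(** * The projections of so(4) to its two diagonal blocks *)

Definition ulh (F : fieldType) : 'Hom('M[F]_(2 + 2), 'M[F]_2) :=
  linfun (@lsubmx F 2 2 2 \o @usubmx F 2 2 (2 + 2)).
Definition drh (F : fieldType) : 'Hom('M[F]_(2 + 2), 'M[F]_2) :=
  linfun (@rsubmx F 2 2 2 \o @dsubmx F 2 2 (2 + 2)).

Lemma ulhE (F : fieldType) (X : 'M[F]_(2 + 2)) : ulh F X = ulsubmx X.
Proof. by rewrite lfunE. Qed.

Lemma drhE (F : fieldType) (X : 'M[F]_(2 + 2)) : drh F X = drsubmx X.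
Proof. by rewrite lfunE. Qed.

Lemma so4_block (F : fieldType) (X : 'M[F]_(2 + 2)) :
  X \in so4 F -> X = block_mx (ulh F X) 0 0 (drh F X).
Proof.
rewrite mem_so4 ulhE drhE => /and4P[/eqP ur /eqP dl _ _].
by rewrite -[LHS]submxK ur dl.
Qed.

Lemma block_so4 (F : fieldType) (A B : 'M[F]_2) :
  (block_mx A 0 0 B \in so4 F) = (A \in sl F 2) && (B \in sl F 2).
Proof.
by rewrite mem_so4 block_mxKur block_mxKdl block_mxKul block_mxKdr !eqxx !mem_sl.
Qed.

Lemma lie_bracket_block (F : fieldType) (A B A' B' : 'M[F]_2) :
  lie_bracket (block_mx A 0 0 B) (block_mx A' 0 0 B') =
  block_mx (lie_bracket A A') 0 0 (lie_bracket B B').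
Proof.
rewrite /lie_bracket !mulmx_block !(mulmx0, mul0mx, add0r, addr0).
by rewrite opp_block_mx add_block_mx !subr0.
Qed.

Lemma so4_subalgebra (F : fieldType) : lie_subalgebra (so4 F).
Proof.
move=> X Y /so4_block-> /so4_block->.
by rewrite lie_bracket_block block_so4 !mem_sl !mxtrace_lie_bracket eqxx.
Qed.

(** The two projections in either order, so that one argument serves both blocks. *)
Definition so4_split (F : fieldType) (f g : 'Hom('M[F]_(2 + 2), 'M[F]_2)) :=
  (f, g) = (ulh F, drh F) \/ (f, g) = (drh F, ulh F).

Lemma so4_split_sym (F : fieldType) f g :
  @so4_split F f g -> so4_split g f.
Proof. by case=> -[-> ->]; [right|left]. Qed.

Lemma so4_split_bracket (F : fieldType) f g :
  @so4_split F f g -> {in so4 F &, forall X Y,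
    f (lie_bracket X Y) = lie_bracket (f X) (f Y)}.
Proof.
move=> fg X Y Xso Yso; rewrite [in LHS](so4_block Xso) [in LHS](so4_block Yso).
rewrite lie_bracket_block.
by case: fg => -[-> _]; rewrite ?ulhE ?drhE (block_mxKul, block_mxKdr).
Qed.

Lemma so4_split_inj (F : fieldType) f g :
  @so4_split F f g -> {in so4 F, forall X, f X = 0 -> g X = 0 -> X = 0}.
Proof.
move=> fg X /so4_block->.
by case: fg => -[-> ->]; rewrite !ulhE !drhE block_mxKul block_mxKdr => -> ->;
  rewrite block_mx0.
Qed.

Lemma so4_split_sl (F : fieldType) f g :
  @so4_split F f g -> {in so4 F, forall X, f X \in sl F 2}.
Proof.
move=> fg X; rewrite mem_so4 => /and4P[_ _].
by case: fg => -[-> _]; rewrite mem_sl ?ulhE ?drhE.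
Qed.

Lemma so4_split_limg (F : fieldType) f g (S : {vspace 'M[F]_(2 + 2)}) :
  so4_split f g -> (S <= so4 F)%VS -> (f @: S <= sl F 2)%VS.
Proof.
move=> fg sS; apply/subvP=> _ /memv_imgP[X /(subvP sS) Xso ->].
exact: so4_split_sl fg _ Xso.
Qed.

(** Both projections of the derived algebra lie in lines, and brackets within a line vanish. Hence
    both projections of the second derived algebra are zero, and so is that algebra. *)
Lemma so4_split_solvable (F : fieldType) f g (I : {vspace 'M[F]_(2 + 2)}) :
  so4_split f g -> (I <= so4 F)%VS -> lie_subalgebra I ->
  (\dim (f @: I) <= 2)%N -> (\dim (g @: I) <= 2)%N -> lie_solvable I.
Proof.
move=> fg sI aI /lie_bracket_dim2[b fb] /lie_bracket_dim2[c gc].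
have fM := so4_split_bracket fg.
have gM := so4_split_bracket (so4_split_sym fg).
exists 2; apply/eqP; rewrite -subv0 /=.
set J := lie_prodv I I.
have sJI : (J <= I)%VS by apply/lie_prodvP.
have sJ : (J <= (f @^-1: <[b]>) :&: (g @^-1: <[c]>))%VS.
  apply/lie_prodvP => X Y XI YI; rewrite memv_cap -!memv_preim.
  rewrite fM ?gM ?(subvP sI) //.
  by rewrite fb ?gc ?memv_img.
have line n (u X Y : 'M[F]_n) : X \in <[u]>%VS -> Y \in <[u]>%VS ->
    lie_bracket X Y = 0.
  move=> /vlineP[a ->] /vlineP[a' ->].
  by rewrite lie_bracketZl lie_bracketZr lie_bracketXX !scaler0.
apply/lie_prodvP => X Y XJ YJ; rewrite memv0; apply/eqP.
have XI := subvP sI _ (subvP sJI _ XJ); have YI := subvP sI _ (subvP sJI _ YJ).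
move: (subvP sJ _ XJ) (subvP sJ _ YJ); rewrite !memv_cap -!memv_preim.
move=> /andP[fX gX] /andP[fY gY].
apply: (so4_split_inj fg); first exact: so4_subalgebra.
  by rewrite fM // (line _ _ _ _ fX fY).
by rewrite gM // (line _ _ _ _ gX gY).
Qed.

Lemma lie_idealxx (F : fieldType) n (S : {vspace 'M[F]_n}) :
  lie_subalgebra S -> lie_ideal S S.
Proof. by []. Qed.

(** * Proper semisimple subalgebras as graphs over one block *)

Lemma so4_split_surjective (F : numFieldType) f g (S : {vspace 'M[F]_(2 + 2)}) :
  so4_split f g -> proper_semisimple_subalgebra S ->
  (f @: S)%VS = sl F 2 \/ (g @: S)%VS = sl F 2.
Proof.
move=> fg [sS _ aS [S0 ssS]].
have [->|/eqP fS] := eqVneq (f @: S)%VS (sl F 2); first by left.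
have [->|/eqP gS] := eqVneq (g @: S)%VS (sl F 2); first by right.
(* Semisimplicity is applied to [S] as an ideal of itself. *)
case: S0; apply: (ssS _ (lie_idealxx aS)).
apply: (so4_split_solvable fg) => //; apply: dim_proper_sl2 => //.
  exact: so4_split_limg fg sS.
exact: so4_split_limg (so4_split_sym fg) sS.
Qed.

Lemma so4_split_kernel (F : numFieldType) f g (S : {vspace 'M[F]_(2 + 2)}) :
  so4_split f g -> proper_semisimple_subalgebra S -> (f @: S)%VS = sl F 2 ->
  {in S, forall X, f X = 0 -> X = 0}.
Proof.
move=> fg [sS /eqP neS aS [_ ssS]] fS.
have gf := so4_split_sym fg.
have fM := so4_split_bracket fg; have gM := so4_split_bracket gf.
pose K := (S :&: lker f)%VS.
suff K0 : K = 0%VS.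
  move=> X XS fX; apply/eqP.
  by rewrite -memv0 -K0 memv_cap XS memv_ker fX eqxx.
have sKS : (K <= S)%VS by exact: capvSl.
have idK : lie_ideal K S.
  split=> // X Y XS; rewrite !memv_cap !memv_ker => /andP[YS /eqP fY].
  by rewrite aS // fM ?(subvP sS) // fY /lie_bracket mulmx0 mul0mx subrr eqxx.
have sK := subv_trans sKS sS.
have aK : lie_subalgebra K by move=> X Y /(subvP sKS) XS; apply: idK.2.
have fK : (f @: K = 0)%VS.
  apply/eqP; rewrite -subv0; apply/subvP=> _ /memv_imgP[X XK ->].
  by move: XK; rewrite memv_cap memv_ker memv0 => /andP[].
(* If [g] is not onto either, [K] has projections of dimension 0 and at most 2, so it is a solvable
   ideal. *)
have [gS|/eqP gS] := eqVneq (g @: S)%VS (sl F 2); last first.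
  apply: ssS => //; apply: (so4_split_solvable fg) => //.
    by rewrite fK dimv0.
  apply: leq_trans (dimvS (limgS g sKS)) _.
  by apply: dim_proper_sl2 => //; apply: so4_split_limg gf sS.
apply/eqP/contraT=> K0; case/negP: neS; rewrite eqEsubv sS /=.
(* Since [g] maps [S] onto sl(2), the image of the ideal [K] is an ideal of sl(2). It is nonzero,
   because [f] already vanishes on [K]. *)
have gK : (g @: K)%VS = sl F 2.
  rewrite sl2_std_span; apply: (sl2_triple_simple (sl2_std_triple F)).
    rewrite -sl2_std_span; split; first exact: so4_split_limg gf sK.
    move=> X Y; rewrite -{1}gS => /memv_imgP[X' X'S ->] /memv_imgP[Y' Y'K ->].
    rewrite -gM ?(subvP sS) // ?(subvP sKS) //.
    by apply: memv_img; apply: idK.2.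
  move=> gK0; case/eqP: K0; apply/eqP; rewrite -subv0; apply/subvP=> X XK.
  rewrite memv0; apply/eqP; apply: (so4_split_inj fg (subvP sK _ XK)).
    by apply/eqP; rewrite -memv0 -fK memv_img.
  by apply/eqP; rewrite -memv0 -gK0 memv_img.
(* Correct [X] in two stages: subtract [Z] in [S] with the same image under [f], then match the
   image of the rest under [g] by some [W] in [K]. *)
apply/subvP=> X Xso.
have := so4_split_sl fg Xso; rewrite -fS => /memv_imgP[Z ZS fXZ].
have XZso : X - Z \in so4 F by exact: memvB Xso (subvP sS _ ZS).
have := so4_split_sl gf XZso; rewrite -gK => /memv_imgP[W WK gW].
rewrite -(subrK Z X) memvD //.
suff -> : X - Z = W by exact: subvP WK.
apply/eqP; rewrite -subr_eq0; apply/eqP; apply: (so4_split_inj fg).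
- by rewrite memvB // (subvP sK).
- move: WK; rewrite memv_cap memv_ker => /andP[_ /eqP fW].
  by rewrite !linearB /= fXZ fW subrr subr0.
- by rewrite linearB /= gW subrr.
Qed.

(** As [f] is injective on [S], the subalgebra is the graph of a homomorphism from sl(2) to the
    other block, and lifts of the standard triple span it. *)
Lemma so4_split_graph (F : numFieldType) f g (S : {vspace 'M[F]_(2 + 2)}) :
  so4_split f g -> proper_semisimple_subalgebra S -> (f @: S)%VS = sl F 2 ->
  exists h x y, [/\ S = <<[:: h; x; y]>>%VS,
    [/\ f h = sl2_h F, f x = sl2_x F & f y = sl2_y F] &
    sl2_triple (g h) (g x) (g y) \/ [/\ g h = 0, g x = 0 & g y = 0]].
Proof.
move=> fg pS fS; have inj := so4_split_kernel fg pS fS.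
have [sS _ aS _] := pS; have [std1 std2 std3 _] := sl2_std_triple F.
have gf := so4_split_sym fg.
have fM := so4_split_bracket fg; have gM := so4_split_bracket gf.
have inS u : u \in [:: sl2_h F; sl2_x F; sl2_y F] -> u \in (f @: S)%VS.
  by move=> uS; rewrite fS sl2_std_span memv_span.
have inj2 : {in S &, injective f}.
  move=> X Y XS YS fXY; apply/eqP; rewrite -subr_eq0; apply/eqP/inj.
    exact: memvB.
  by rewrite linearB /= fXY subrr.
have [|h hS fh] := memv_imgP (inS (sl2_h F) _); first by rewrite !inE eqxx.
have [|x xS fx] := memv_imgP (inS (sl2_x F) _).
  by rewrite !inE eqxx orbT.
have [|y yS fy] := memv_imgP (inS (sl2_y F) _).
  by rewrite !inE eqxx !orbT.
exists h, x, y; split=> //.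
  apply/eqP; rewrite eqEsubv andbC; apply/andP; split; first exact: span3_subv.
  apply/subvP=> X XS; have := memv_img f XS.
  rewrite fS sl2_std_span fh fx fy => /span3P[a [b [c]]].
  rewrite -!linearZ -!linearD /= => /inj2-> //; first exact: mem_span3.
  by rewrite !memvD ?memvZ.
have [hso xso yso] := And3 (subvP sS _ hS) (subvP sS _ xS) (subvP sS _ yS).
(* The lifts inherit the relations of the standard triple by injectivity of [f], and [g] carries
   these over to the other block. *)
have hx : lie_bracket h x = 2%:R *: x.
  by apply: inj2; rewrite ?aS ?memvZ // fM // linearZ /= -fh -fx.
have hy : lie_bracket h y = - 2%:R *: y.
  by apply: inj2; rewrite ?aS ?memvZ // fM // linearZ /= -fh -fy.
have xy : lie_bracket x y = h.
  by apply: inj2; rewrite ?aS // fM // -fh -fx -fy.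
have ghx : lie_bracket (g h) (g x) = 2%:R *: g x by rewrite -gM // hx linearZ.
have ghy : lie_bracket (g h) (g y) = - 2%:R *: g y by rewrite -gM // hy linearZ.
have gxy : lie_bracket (g x) (g y) = g h by rewrite -gM // xy.
(* When [g h = 0], the relations with [h] read [0 = 2 g x] and [0 = -2 g y]. *)
have [gh|/eqP gh] := eqVneq (g h) 0; last by left.
have two0 : 2%:R != 0 :> F by rewrite pnatr_eq0.
have b0 Y : lie_bracket 0 Y = 0 :> 'M[F]_2.
  by rewrite /lie_bracket mul0mx mulmx0 subrr.
right; split=> //; apply/eqP.
  by move/eqP: ghx; rewrite gh b0 eq_sym scaler_eq0 (negPf two0).
by move/eqP: ghy; rewrite gh b0 eq_sym scaler_eq0 oppr_eq0 (negPf two0).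
Qed.

(** * The three normal forms *)

Lemma sl2_triple_block (F : fieldType) (h x y h' x' y' : 'M[F]_2) :
  lie_bracket h x = 2%:R *: x -> lie_bracket h y = - 2%:R *: y ->
  lie_bracket x y = h ->
  lie_bracket h' x' = 2%:R *: x' -> lie_bracket h' y' = - 2%:R *: y' ->
  lie_bracket x' y' = h' -> h <> 0 \/ h' <> 0 ->
  sl2_triple (block_mx h 0 0 h') (block_mx x 0 0 x') (block_mx y 0 0 y').
Proof.
move=> hx hy xy hx' hy' xy' n0; split.
- by rewrite lie_bracket_block scale_block_mx hx hx' !scaler0.
- by rewrite lie_bracket_block scale_block_mx hy hy' !scaler0.
- by rewrite lie_bracket_block xy xy'.
- by rewrite -block_mx0 => /eq_block_mx[h0 _ _ h0']; case: n0.
Qed.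

(** [E] counts from 1 and ['I_2] from 0, so [i.+1] addresses the first block and [i.+3] the
    second. *)
Lemma E_block (F : fieldType) (i j : 'I_2) :
  E F i.+1 j.+1 = block_mx (delta_mx i j) 0 0 0 /\
  E F i.+3 j.+3 = block_mx 0 0 0 (delta_mx i j).
Proof.
have il (k : 'I_2) : inord k = lshift 2 k :> 'I_(2 + 2).
  by apply: val_inj; rewrite /= inordK // (ltn_trans (ltn_ord k)).
have ir (k : 'I_2) : inord k.+2 = rshift 2 k :> 'I_(2 + 2).
  by apply: val_inj; rewrite /= inordK //; apply: (ltn_ord k).
rewrite /E /= !il !ir; split.
  by rewrite -[LHS]/(@delta_mx F (2 + 2) (2 + 2) (lshift 2 i) (lshift 2 j))
    delta_mx_ushift delta_mx_lshift /block_mx row_mx0.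
by rewrite -[LHS]/(@delta_mx F (2 + 2) (2 + 2) (rshift 2 i) (rshift 2 j))
  delta_mx_dshift delta_mx_rshift /block_mx row_mx0.
Qed.

(** The embeddings of 2 x 2 matrices behind [A11], [A12] and [A13], for the indices 0, 1, 2: into
    the first block, into the second, and diagonally. *)
Definition A1_gen (F : fieldType) (i : 'I_3) (u : 'M[F]_2) : 'M[F]_(2 + 2) :=
  block_mx (if i == 1 then 0 else u) 0 0 (if i == 0 then 0 else u).

Lemma A1E (F : fieldType) (i : 'I_3) :
  A1 F i = <<[:: A1_gen i (sl2_h F); A1_gen i (sl2_x F); A1_gen i (sl2_y F)]>>%VS.
Proof.
have ul k l := (E_block F k l).1; have dr k l := (E_block F k l).2.
have [e11 e12 e21 e22] := And4 (ul 0 0) (ul 0 1) (ul 1 0) (ul 1 1).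
have [e33 e34 e43 e44] := And4 (dr 0 0) (dr 0 1) (dr 1 0) (dr 1 1).
rewrite /= in e11 e12 e21 e22 e33 e34 e43 e44.
case: i => [[|[|[|//]]] ?]; rewrite /A1 (tnth_nth 0%VS) /= /A1_gen /=;
  rewrite /A11 /A12 /A13 /h1 /h2 /x1 /x2 /y1 /y2;
  rewrite ?(e11, e12, e21, e22, e33, e34, e43, e44);
  by rewrite ?(opp_block_mx, add_block_mx, oppr0, addr0, add0r).
Qed.

Lemma A1_triple (F : numFieldType) (i : 'I_3) :
  sl2_triple (A1_gen i (sl2_h F)) (A1_gen i (sl2_x F)) (A1_gen i (sl2_y F)).
Proof.
have [hx hy xy h0] := sl2_std_triple F.
have b0 Y : lie_bracket 0 Y = 0 :> 'M[F]_2.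
  by rewrite /lie_bracket mul0mx mulmx0 subrr.
by case: i => [[|[|[|//]]] ?]; apply: sl2_triple_block => //=;
  rewrite ?b0 ?scaler0 //; (by left) || (by right).
Qed.

(** The span is simple, whereas so(4) is not: its second block [K] is a nonzero ideal that misses
    the first block. *)
Lemma sl2_triple_proper_semisimple (F : numFieldType) (h x y : 'M[F]_(2 + 2)) :
  sl2_triple h x y -> (<<[:: h; x; y]>> <= so4 F)%VS ->
  proper_semisimple_subalgebra <<[:: h; x; y]>>%VS.
Proof.
move=> T sL; split=> //;
  [|exact: sl2_triple_subalgebra|exact: sl2_triple_semisimple].
move=> eL; have [_ _ _ h0] := sl2_std_triple F.
have hsl : sl2_h F \in sl F 2 by rewrite sl2_std_span memv_span // !inE eqxx.
pose K := (so4 F :&: lker (ulh F))%VS.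
have memK X : (X \in K) = (X \in so4 F) && (ulh F X == 0).
  by rewrite memv_cap memv_ker.
have eK : K = <<[:: h; x; y]>>%VS.
  apply: (sl2_triple_simple T); first split.
  - by rewrite eL capvSl.
  - move=> X Y; rewrite eL !memK => Xso /andP[Yso /eqP Y0].
    rewrite so4_subalgebra //= (so4_split_bracket (or_introl erefl)) //.
    by rewrite Y0 /lie_bracket mulmx0 mul0mx subrr.
  - move=> K0; have : block_mx 0 0 0 (sl2_h F) \in K.
      by rewrite memK ulhE block_mxKul eqxx block_so4 mem0v hsl.
    by rewrite K0 memv0 -block_mx0 => /eqP/eq_block_mx[].
have : block_mx (sl2_h F) 0 0 0 \in K by rewrite eK eL block_so4 mem0v hsl.
by rewrite memK ulhE block_mxKul => /andP[_ /eqP].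
Qed.

Lemma A1_proper_semisimple (F : numFieldType) (i : 'I_3) :
  proper_semisimple_subalgebra (A1 F i).
Proof.
rewrite A1E; apply: sl2_triple_proper_semisimple (A1_triple F i) _.
have sg u : u \in [:: sl2_h F; sl2_x F; sl2_y F] -> A1_gen i u \in so4 F.
  move=> su; have usl : u \in sl F 2 by rewrite sl2_std_span memv_span.
  by rewrite block_so4; do 2 case: ifP => _; rewrite ?mem0v ?usl.
by apply: span3_subv; apply: sg; rewrite !inE eqxx ?orbT.
Qed.

Lemma A1_isomorphic (F : numFieldType) (i : 'I_3) :
  lie_isomorphic (A1 F i) (sl F 2).
Proof.
rewrite A1E sl2_std_span.
exact: sl2_triple_isomorphic (A1_triple F i) (sl2_std_triple F).
Qed.

(** * Inequivalence of the normal forms *)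

(** Which of the two projections vanish is the invariant that tells the three normal forms apart. *)
Lemma A1_sub_ker (F : numFieldType) (i : 'I_3) :
  (A1 F i <= lker (ulh F))%VS = (i == 1) /\
  (A1 F i <= lker (drh F))%VS = (i == 0).
Proof.
have [_ _ _ h0] := sl2_std_triple F.
have gen (f : 'Hom('M[F]_(2 + 2), 'M[F]_2)) (b : bool) :
    (forall u, f (A1_gen i u) = if b then 0 else u) ->
    (A1 F i <= lker f)%VS = b.
  move=> fE; rewrite A1E.
  apply/idP/idP => [/span_subvP/(_ (A1_gen i (sl2_h F)))|].
    rewrite inE eqxx memv_ker fE => /(_ isT).
    by case: b {fE} => // /eqP.
  by move=> bT; apply: span3_subv; rewrite memv_ker fE bT.
by split; apply: gen => u; rewrite ?ulhE ?drhE (block_mxKul, block_mxKdr).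
Qed.

Lemma SL2xSL2_block (F : fieldType) (a b : 'M[F]_2) :
  \det a = 1 -> \det b = 1 -> block_mx a 0 0 b \in @SL2xSL2 F.
Proof.
move=> da db; rewrite unfold_in.
by rewrite block_mxKur block_mxKdl block_mxKul block_mxKdr da db !eqxx.
Qed.

Lemma conj_by_block (F : fieldType) (a b u v : 'M[F]_2) :
  \det a = 1 -> \det b = 1 ->
  conj_by (block_mx a 0 0 b) (block_mx u 0 0 v) =
  block_mx (conj_by a u) 0 0 (conj_by b v).
Proof.
move=> da db; rewrite !conj_byE invmx_block_diag; last first.
  by rewrite unitmxE det_ublock da db mulr1 unitr1.
by rewrite !mulmx_block !(mulmx0, mul0mx, add0r, addr0).
Qed.

Lemma conj_by_eq0 (F : fieldType) n (a u : 'M[F]_n) :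
  a \in unitmx -> (conj_by a u == 0) = (u == 0).
Proof.
move=> ua; rewrite conj_byE; apply/eqP/eqP => [e|->]; last first.
  by rewrite mulmx0 mul0mx.
by rewrite -[u](mulKmx ua) -[a *m u](mulmxKV ua) e mul0mx mulmx0.
Qed.

(** An inner automorphism conjugates each block separately by an invertible matrix, so it preserves
    the vanishing of a block. *)
Lemma so4_equiv_sub_ker (F : fieldType) f g (S S' : {vspace 'M[F]_(2 + 2)}) :
  so4_split f g -> (S <= so4 F)%VS -> so4_equiv S S' ->
  (S' <= lker f)%VS = (S <= lker f)%VS.
Proof.
move=> fg sS [_ [A + ->] <-]; rewrite unfold_in.
move=> /and4P[/eqP ur /eqP dl /eqP da /eqP db].
have eA : A = block_mx (ulsubmx A) 0 0 (drsubmx A).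
  by rewrite -[LHS]submxK ur dl.
have unit1 (a : 'M[F]_2) : \det a = 1 -> a \in unitmx.
  by rewrite unitmxE => ->; apply: unitr1.
have key X : X \in S -> (f (conj_by A X) == 0) = (f X == 0).
  move=> /(subvP sS)/so4_block->; rewrite eA conj_by_block //.
  by case: fg => -[-> _]; rewrite ?ulhE ?drhE ?block_mxKul ?block_mxKdr conj_by_eq0 //
    unit1.
apply/subvP/subvP => sk X XS.
  by rewrite memv_ker -key // -memv_ker sk // memv_img.
by have /memv_imgP[Y YS ->] := XS; rewrite memv_ker key // -memv_ker sk.
Qed.

Lemma so4_equiv_A1_inj (F : numFieldType) (S : {vspace 'M[F]_(2 + 2)}) i j :
  (S <= so4 F)%VS -> so4_equiv S (A1 F i) -> so4_equiv S (A1 F j) -> i = j.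
Proof.
move=> sS Si Sj.
have ul := so4_equiv_sub_ker (or_introl erefl) sS.
have dr := so4_equiv_sub_ker (or_intror erefl) sS.
have [ui di] := A1_sub_ker F i; have [uj dj] := A1_sub_ker F j.
have : (i == 1) = (j == 1) by rewrite -ui -uj (ul _ Si) (ul _ Sj).
have : (i == 0) = (j == 0) by rewrite -di -dj (dr _ Si) (dr _ Sj).
case: i {Si ui di} => [[|[|[|//]]] ?];
  case: j {Sj uj dj} => [[|[|[|//]]] ?] //= _ _;
  exact: val_inj.
Qed.

(** * Reduction to a normal form and the classification *)

Lemma so4_equivP (F : fieldType) (S S' : {vspace 'M[F]_(2 + 2)}) a b :
  \det a = 1 -> \det b = 1 -> (conj_by (block_mx a 0 0 b) @: S)%VS = S' ->
  so4_equiv S S'.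
Proof.
move=> da db e; exists (conj_by (block_mx a 0 0 b)) => //.
by exists (block_mx a 0 0 b) => //; apply: SL2xSL2_block.
Qed.

Lemma conj_by1 (F : fieldType) n (u : 'M[F]_n) : conj_by 1%:M u = u.
Proof. by rewrite conj_byE invmx1 mulmx1 mul1mx. Qed.

Lemma so4_equiv_A1 (F : numClosedFieldType) (S : {vspace 'M[F]_(2 + 2)}) :
  proper_semisimple_subalgebra S -> exists i, so4_equiv S (A1 F i).
Proof.
move=> pS; have [sS _ _ _] := pS.
have uldr : so4_split (ulh F) (drh F) by left.
have drul := so4_split_sym uldr.
have [ulS|/eqP ulS] := eqVneq (ulh F @: S)%VS (sl F 2).
  have [h [x [y [eS [uh ux uy] dr]]]] := so4_split_graph uldr pS ulS.
  have [hso xso yso] : [/\ h \in so4 F, x \in so4 F & y \in so4 F].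
    by split; apply: (subvP sS); rewrite eS memv_span // !inE eqxx ?orbT.
  case: dr => [T|[dh dx dy]].
    (* The upper block already holds the standard triple, so only the lower one is conjugated. [B]
       carries the standard triple to the given one, hence its inverse is used, and the result is
       the diagonal [A13]. *)
    have [B [dB Bh Bx By]] := sl2_triple_conj T.
    have uB : B \in unitmx by rewrite unitmxE dB unitr1.
    have dB' : \det (invmx B) = 1 by rewrite det_inv dB invr1.
    have cB u v : B *m u = v *m B -> conj_by (invmx B) v = u.
      by move=> e; rewrite conj_byE invmxK -mulmxA -e mulKmx.
    exists 2%R; apply: (so4_equivP (det1 _ _) dB'); rewrite A1E eS limg_span /=.
    rewrite (so4_block hso) (so4_block xso) (so4_block yso).
    rewrite !conj_by_block ?det1 // !conj_by1.
    rewrite (cB _ _ Bh) (cB _ _ Bx) (cB _ _ By).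
    by rewrite uh ux uy.
  exists 0; apply: (so4_equivP (det1 _ _) (det1 _ _)).
  rewrite A1E eS limg_span /=.
  rewrite (so4_block hso) (so4_block xso) (so4_block yso).
  by rewrite !conj_by_block ?det1 // !conj_by1 uh ux uy dh dx dy.
have [//|drS] := so4_split_surjective uldr pS.
have [h [x [y [eS [dh dx dy] ul]]]] := so4_split_graph drul pS drS.
have [hso xso yso] : [/\ h \in so4 F, x \in so4 F & y \in so4 F].
  by split; apply: (subvP sS); rewrite eS memv_span // !inE eqxx ?orbT.
case: ul => [T|[uh ux uy]].
  (* A triple in the upper block would span sl(2), but in this case the upper projection is not
     onto. *)
  by case: ulS; rewrite eS limg_span /= (sl2_triple_span T).
exists 1; apply: (so4_equivP (det1 _ _) (det1 _ _)).
rewrite A1E eS limg_span /=.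
rewrite (so4_block hso) (so4_block xso) (so4_block yso).
by rewrite !conj_by_block ?det1 // !conj_by1 uh ux uy dh dx dy.
Qed.

Local Open Scope complex_scope.

Theorem theorem6p1 (R : realType) :
  (forall i : 'I_3,
     proper_semisimple_subalgebra (A1 R[i] i) /\
     lie_isomorphic (A1 R[i] i) (sl R[i] 2)) /\
  (forall S : {vspace 'M[R[i]]_(2 + 2)},
     proper_semisimple_subalgebra S ->
     exists! i : 'I_3, so4_equiv S (A1 R[i] i)).
Proof.
split=> [i | S pS].
  by split; [apply: A1_proper_semisimple | apply: A1_isomorphic].
have [i Si] := so4_equiv_A1 pS.
exists i; split=> // j; apply: so4_equiv_A1_inj Si.
by case: pS.
Qed.
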